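(* Let $q$ be a complex number with $0<|q|<1$. For all integers $m\ge 1$ and $0\le a\le m-1$, we have $$\sum_{n_m,\dots,n_1\ge 0}\frac{(-1)^{n_m}q^{\binom{n_m+1}{2}+\cdots+\binom{n_1+1}{2}}}{(-q)_{n_m}}\prod_{i=1}^{m-1}\begin{bmatrix} n_{i+1}+\delta_{a,i}\\ n_i\end{bmatrix}=\sum_{n\in\mathbb{Z}}\mathrm{sgn}(-n)\,q^{(m+2)\binom{n}{2}+(a+1)n}.$$
   Context: Notation: $(x)_n=(x;q)_n=\prod_{j=0}^{n-1}(1-xq^j)$ for $n\ge 0$. The $q$-binomial coefficient is $\begin{bmatrix} n\\k\end{bmatrix}=\frac{(q)_n}{(q)_{n-k}(q)_k}$ if $0\le k\le n$, and $0$ otherwise. $\binom{n}{2}=n(n-1)/2$ for every integer $n$; $\delta_{i,j}$ is the Kronecker delta; empty products equal $1$. $\mathrm{sgn}(n)=1$ if $n\ge 0$ and $\mathrm{sgn}(n)=-1$ if $n<0$ (so $\mathrm{sgn}(0)=1$). *)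

(* Defs.v *)
From HB Require Import structures.
From mathcomp Require Import all_boot all_order all_algebra.
From mathcomp Require Import finmap.
From mathcomp Require Import complex.
From mathcomp Require Import boolp classical_sets reals topology normedtype.
From mathcomp Require summability.

Set Implicit Arguments.
Unset Strict Implicit.
Unset Printing Implicit Defensive.

Import Order.TTheory GRing.Theory Num.Theory.
Import numFieldNormedType.Exports.

Local Open Scope classical_set_scope.
Local Open Scope ring_scope.

Section QSeries.
Variable F : fieldType.
Implicit Types (x q : F) (n k : nat).

Definition qpoch x q n : F := \prod_(0 <= j < n) (1 - x * q ^+ j).

Definition qbinom q n k : F :=
  if (k <= n)%N then qpoch q q n / (qpoch q q (n - k) * qpoch q q k) else 0.

End QSeries.

(* The convention is sgn 0 = 1, unlike Num.sg and sgz. *)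
Definition sgn (n : int) : int := if 0 <= n then 1 else -1.

(* The division is exact, since n * (n - 1) is even. *)
Definition binz2 (n : int) : int := (n * (n - 1) %/ 2)%Z.

(* Unordered (equivalently, absolutely convergent) summation of a family of
   complex numbers: the limit of its finite partial sums along the filter of
   finite subsets of I.  The regular module R[i]^o carries the norm topology. *)
Section UnorderedSum.
Variables (R : realType) (I : choiceType).
Implicit Type f : I -> R[i]^o.

Definition csummable f : Prop :=
  cvg (summability.partial_sum f @ summability.totally).

Definition csum f : R[i] := summability.sum f.

End UnorderedSum.

Section Identity.
Variables (R : realType) (q : R[i]) (m a : nat).

(* The tuple n lists n_1, ..., n_m, so that n_i is the entry of rank i - 1. *)
Definition lhs_term (n : m.-tuple nat) : R[i] :=
  let n_ i := nth 0%N n i.-1 in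
  (-1) ^+ n_ m * q ^+ (\sum_(1 <= i < m.+1) 'C((n_ i).+1, 2)) /
    qpoch (- q) q (n_ m) *
  \prod_(1 <= i < m) qbinom q (n_ i.+1 + (a == i)) (n_ i).

Definition rhs_term (n : int) : R[i] :=
  (sgn (- n))%:~R * q ^ (m.+2%:Z * binz2 n + a.+1%:Z * n).

End Identity.

(* Main.v *)
Require Import Defs.
From mathcomp Require Import all_boot all_order all_algebra.
From mathcomp Require Import finmap complex.
From mathcomp Require Import boolp classical_sets reals topology normedtype.
From mathcomp Require Import sequences.
From mathcomp Require summability.
From mathcomp Require Import ring lra zify.

(* Up to the shift [n_(a+1) + 1], the multisum iterates the Bailey lemma with
   a = q, rho_1 -> oo, rho_2 = -q: one step multiplies alpha_r by
   q^(r(r+1)/2), and it is started at the unit Bailey pair.  At the level where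
   the shift occurs, an antisymmetry under r -> -1-r of the Bailey sequence
   turns the pair at n+1 into a pair at n for a new sequence, which carries the
   parameter a.  The sum over n_m is the Bailey lemma with rho_2 = q; its
   kernel sum is evaluated by creative telescoping with an explicit error for
   its partial sums, so that the partial sums over n_m <= M converge to the
   false theta series.  Both families are dominated by summable ones, hence
   unordered summation may be computed along these exhaustions. *)

Set Implicit Arguments.
Unset Strict Implicit.
Unset Printing Implicit Defensive.

Import Order.TTheory GRing.Theory Num.Theory.
Import numFieldNormedType.Exports.
Import Normc.
Local Open Scope ring_scope.

(** * Bailey pairs *)

Lemma bin2S n : 'C(n.+1, 2) = ('C(n, 2) + n)%N.
Proof. by rewrite binS bin1. Qed.

Ltac field_nz :=
  field; repeat (apply/andP; split); by [assumption | rewrite ?oner_eq0].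

Lemma big_nat_triangle (V : nmodType) (f : nat -> nat -> V) n :
  \sum_(0 <= k < n) \sum_(0 <= r < k.+1) f k r =
  \sum_(0 <= r < n) \sum_(0 <= i < n - r) f (r + i)%N r.
Proof.
elim: n => [|n IH]; first by rewrite !big_nil.
rewrite big_nat_recr //= IH [in RHS]big_nat_recr //= subSnn big_nat1 addn0.
rewrite big_nat_recr //= addrA -big_split /=; congr (_ + _).
apply: eq_big_nat => r /andP[_ lt_rn].
by rewrite subSn ?(ltnW lt_rn) // big_nat_recr //= subnKC // ltnW.
Qed.

(** * Identities over a field where the denominators [1 - q ^+ n.+1] and [1 + q ^+ n.+1] do not
    vanish *)

Section Algebra.
Variables (F : fieldType) (q : F).
Hypothesis q_regular : forall n, 1 - q ^+ n.+1 != 0.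
Hypothesis Nq_regular : forall n, 1 + q ^+ n.+1 != 0.

Local Notation P := (qpoch q q).
Local Notation Pm := (qpoch (- q) q).

Lemma qpoch0 x : qpoch x q 0 = 1.
Proof. by rewrite /qpoch big_nil. Qed.

Lemma qpochS x n : qpoch x q n.+1 = qpoch x q n * (1 - x * q ^+ n).
Proof. by rewrite /qpoch big_nat_recr. Qed.

Lemma qfactS n : P n.+1 = P n * (1 - q ^+ n.+1).
Proof. by rewrite qpochS -exprS. Qed.

Lemma qfactNS n : Pm n.+1 = Pm n * (1 + q ^+ n.+1).
Proof. by rewrite qpochS mulNr opprK -exprS. Qed.

Lemma qfact_neq0 n : P n != 0.
Proof.
elim: n => [|n IH]; first by rewrite qpoch0 oner_eq0.
by rewrite qfactS mulf_neq0.
Qed.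

Lemma qfactN_neq0 n : Pm n != 0.
Proof.
elim: n => [|n IH]; first by rewrite qpoch0 oner_eq0.
by rewrite qfactNS mulf_neq0.
Qed.

(* The kernel of the Bailey transform relative to [q], up to a factor [1 - q]. *)
Definition baileyK N r : F := (P (N - r) * P (N + r).+1)^-1.

(* The sequence after [b + c] Bailey steps: [b] is 0 up to the level of the
   shift, and [a] beyond it. *)
Definition alpha b c r : F :=
  (-1) ^+ r * (q ^+ ((b + c).+1 * 'C(r, 2) + c * r) -
               q ^+ ((b + c).+1 * 'C(r.+1, 2) + b.+1 * r.+1)).

Lemma alpha_shift b c r : q ^+ 'C(r.+1, 2) * alpha b c r = alpha b c.+1 r.
Proof.
rewrite /alpha addnS mulrCA mulrBr -!exprD.
by congr (_ * (_ ^+ _ - _ ^+ _)); rewrite ?bin2S; lia.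
Qed.

(** The sum is Gosper-summable: the closed form of its partial sums is checked by induction on [k].
    The bound on [k] keeps [n.+1 - k] a true subtraction. *)
Lemma alpha0_sum_partial n k : (k <= n.+1)%N ->
  \sum_(0 <= r < k) alpha 0 0 r * baileyK n.+1 r =
  (-1) ^+ k * q ^+ 'C(k, 2) * (q ^+ k - 1) /
    ((1 - q ^+ n.+1) * (P (n.+1 - k) * P (n.+1 + k))).
Proof.
elim: k => [|k IH] le_kn; first by rewrite big_nil expr0 subrr mulr0 mul0r.
rewrite big_nat_recr //= IH ?(ltnW le_kn) //.
(* Writing [n = k + d] removes the truncated subtractions; once the powers of [q] are made
   variables, a rational identity remains. *)
have [d ->] : exists d, n = (k + d)%N by exists (n - k)%N; lia.
rewrite /alpha /baileyK.
have -> : ((k + d).+1 - k = d.+1)%N by lia.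
have -> : ((k + d).+1 - k.+1 = d)%N by lia.
have -> : ((k + d).+1 + k.+1 = (k + d + k).+2)%N by lia.
have -> : ((k + d).+1 + k = (k + d + k).+1)%N by lia.
have -> : ((0 + 0).+1 * 'C(k.+1, 2) + 1 * k.+1 = 'C(k, 2) + k + k + 1)%N.
  by rewrite bin2S; lia.
have -> : ((0 + 0).+1 * 'C(k, 2) + 0 * k = 'C(k, 2))%N by lia.
rewrite bin2S !qfactS !(exprD, exprS, expr0).
have h1 := qfact_neq0 d; have h2 := qfact_neq0 (k + d + k).
have h3 := q_regular (k + d); have h4 := q_regular (k + d + k).+1.
have h5 := q_regular d; have h6 := q_regular (k + d + k).
rewrite !(exprD, exprS) in h3 h4 h5 h6.
move: (q ^+ k) (q ^+ d) (q ^+ 'C(k, 2)) h3 h4 h5 h6 => x y t h3 h4 h5 h6.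
field_nz.
Qed.

Lemma alpha0_sum n :
  \sum_(0 <= r < n.+1) alpha 0 0 r * baileyK n r = (n == 0%N)%:R.
Proof.
case: n => [|n].
  rewrite big_nat1 /alpha /baileyK /= addn0 qfactS qpoch0.
  have h := q_regular 0; rewrite expr1 in h.
  by rewrite !muln0 expr0 !mul1r divff.
(* The closed form stops at [k = n.+1]; the last term [r = n.+1] is added by hand and cancels it. *)
rewrite big_nat_recr //= alpha0_sum_partial // /alpha /baileyK.
rewrite subnn addSn addnS qpoch0 (qfactS (n + n).+2).
have h1 := qfact_neq0 (n + n).+2; move: (P _) h1 => p h1.
have h2 := q_regular (n + n).+2.
have h3 := q_regular n; have h4 := q_regular 0.
have -> : ((0 + 0).+1 * 'C(n.+1, 2) + 0 * n.+1 = 'C(n.+1, 2))%N by lia.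
have -> : ((0 + 0).+1 * 'C(n.+2, 2) + 1 * n.+2 = 'C(n.+1, 2) + n + n + 3)%N.
  by rewrite [in LHS]bin2S; lia.
move: 'C(n.+1, 2) => c; rewrite !(exprD, exprS, expr0) in h2 h3 h4 *.
move: (q ^+ n) (q ^+ c) h2 h3 h4 => x t h2 h3 h4.
field_nz.
Qed.

(* The creative-telescoping certificate of the q-Chu-Vandermonde sum below is
   [- q ^+ (n.+1 - i) * (1 - q ^+ i) * (1 - q ^+ (r.*2 + i).+1)]. *)
Definition vdm r n i : F :=
  q ^+ 'C((r + i).+1, 2) * Pm (r + i) / (P (n - i) * P i * P (r.*2 + i).+1).

(** At [k = n.+1] this gives the first-order recurrence in [n] behind [vdm_sum]. It goes no further
    because [vdm r n n.+1] need not be zero: [n - i] truncates there. *)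
Lemma vdm_telescope r n k : (k <= n.+1)%N ->
  \sum_(0 <= i < k) ((1 - q ^+ n.+1) * (1 - q ^+ (r.*2 + n).+2) * vdm r n.+1 i
                     - (1 + q ^+ (r + n).+1) * vdm r n i) =
  - q ^+ (n.+1 - k) * (1 - q ^+ k) * (1 - q ^+ (r.*2 + k).+1) * vdm r n.+1 k.
Proof.
elim: k => [|k IH] le_kn; first by rewrite big_nil expr0 subrr mulr0 !mul0r.
rewrite big_nat_recr //= IH ?(ltnW le_kn) // /vdm.
have [d ->] : exists d, n = (k + d)%N by exists (n - k)%N; lia.
have -> : ((k + d).+1 - k = d.+1)%N by lia.
have -> : ((k + d).+1 - k.+1 = d)%N by lia.
have -> : (k + d - k = d)%N by lia.
rewrite !addnS -!addnn !bin2S !qfactS !qfactNS.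
have h1 := qfact_neq0 d; have h2 := qfact_neq0 (r + r + k).
have h3 := q_regular d; have h4 := q_regular (r + r + k).
have h5 := q_regular (r + r + k).+1; have h6 := qfact_neq0 k.
have h7 := q_regular k.
move: 'C(_, 2) (P d) (P (r + r + k)) (P k) (Pm _) h1 h2 h6
  => c P1 P2 P3 P4 h1 h2 h6.
rewrite !(exprD, exprS) in h3 h4 h5 h7 *.
move: (q ^+ k) (q ^+ d) (q ^+ r) (q ^+ c) h3 h4 h5 h7 => x y z t h3 h4 h5 h7.
field_nz.
Qed.

(** The q-Chu-Vandermonde sum with upper parameters [q ^ (-n)], [- q ^ (r+1)] and lower parameter
    [q ^ (2r+2)], by induction on [n] through the telescoped recurrence. *)
Lemma vdm_sum r n :
  \sum_(0 <= i < n.+1) vdm r n i =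
  Pm (r + n) * q ^+ 'C(r.+1, 2) / (P n * P (r.*2 + n).+1).
Proof.
elim: n => [|n IH].
  by rewrite big_nat1 /vdm !addn0 subnn qpoch0 !mul1r (mulrC (q ^+ _)).
pose A := (1 - q ^+ n.+1) * (1 - q ^+ (r.*2 + n).+2).
have A0 : A != 0 by rewrite mulf_neq0.
apply: (mulfI A0).
have := vdm_telescope r (leqnn n.+1).
rewrite sumrB -!mulr_sumr IH -/A => /eqP; rewrite subr_eq => /eqP E.
(* The boundary term at [k = n.+1] is [- A * vdm r n.+1 n.+1], which the term [i = n.+1] cancels. *)
rewrite big_nat_recr //= mulrDr E.
rewrite /A /vdm !addnS !subnn -!addnn qpoch0 !qfactS !qfactNS.
have h1 := qfact_neq0 n; have h2 := qfact_neq0 (r + r + n).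
have h3 := q_regular n; have h4 := q_regular (r + r + n).
have h5 := q_regular (r + r + n).+1.
move: ('C((r + n).+2, 2)) ('C(r.+1, 2)) => c c'.
move: (P n) (P (r + r + n)) (Pm _) h1 h2 => P1 P2 P3 h1 h2.
rewrite !(exprD, exprS, expr0) in h3 h4 h5 *.
move: (q ^+ n) (q ^+ r) (q ^+ c) (q ^+ c') h3 h4 h5 => x y z t h3 h4 h5.
field_nz.
Qed.


(** The Bailey lemma with rho_1 -> oo and rho_2 = -q. Carrying [P k * Pm k] along with the beta
    sequence makes the step reproduce its own form, so that it can be iterated. After exchanging the
    sums, the inner one is [vdm_sum]. *)
Lemma bailey_step (al : nat -> F) n :
  \sum_(0 <= k < n.+1) qbinom q n k * q ^+ 'C(k.+1, 2) *
    (P k * Pm k * \sum_(0 <= r < k.+1) al r * baileyK k r) =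
  P n * Pm n * \sum_(0 <= r < n.+1) q ^+ 'C(r.+1, 2) * al r * baileyK n r.
Proof.
under eq_bigr => k _ do rewrite !mulr_sumr.
rewrite big_nat_triangle mulr_sumr; apply: eq_big_nat => r /andP[_ le_rn].
rewrite ltnS in le_rn; have [d {le_rn}->] : exists d, n = (r + d)%N.
  by exists (n - r)%N; lia.
have -> : ((r + d).+1 - r = d.+1)%N by lia.
transitivity (P (r + d) * al r * \sum_(0 <= i < d.+1) vdm r d i).
  rewrite mulr_sumr; apply: eq_big_nat => i /andP[_ le_id].
  rewrite /qbinom /vdm /baileyK leq_add2l -ltnS le_id.
  have -> : (r + d - (r + i) = d - i)%N by lia.
  have -> : (r + i - r = i)%N by lia.
  have -> : (r + i + r = r.*2 + i)%N by lia.
  have h1 := qfact_neq0 (d - i); have h2 := qfact_neq0 (r + i).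
  have h3 := qfact_neq0 i; have h4 := qfact_neq0 (r.*2 + i).+1.
  field_nz.
rewrite vdm_sum /baileyK.
have -> : (r + d - r = d)%N by lia.
have -> : (r + d + r = r.*2 + d)%N by lia.
have h1 := qfact_neq0 d; have h2 := qfact_neq0 (r.*2 + d).+1.
field_nz.
Qed.

Lemma alpha_switch_partial a n k : (k <= n.+1)%N ->
  \sum_(0 <= r < k) ((1 - q ^+ (n.+1).*2) * alpha 0 a.+1 r * baileyK n.+1 r
                     - alpha a 1 r * baileyK n r) =
  - (-1) ^+ k * q ^+ (a.+2 * 'C(k, 2)) * baileyK n.+1 k *
    (q ^+ (a.+1 * k) * (1 - q ^+ (n.+1 + k)) - q ^+ k * (1 - q ^+ (n.+1 - k))) *
    (1 - q ^+ (n + k).+2).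
Proof.
elim: k => [|k IH] le_kn.
  by rewrite big_nil !muln0 expr0 !mul1r subn0 addn0 subrr mulr0 mul0r.
rewrite big_nat_recr //= IH ?(ltnW le_kn) // /alpha /baileyK.
have [d ->] : exists d, n = (k + d)%N by exists (n - k)%N; lia.
have -> : ((k + d).+1 - k = d.+1)%N by lia.
have -> : ((k + d).+1 - k.+1 = d)%N by lia.
have -> : (k + d - k = d)%N by lia.
rewrite bin2S; move: 'C(k, 2) => c.
have -> : ((0 + a.+1).+1 * c + a.+1 * k = a.+2 * c + a * k + k)%N by lia.
have -> : ((0 + a.+1).+1 * (c + k) + 1 * k.+1 =
  a.+2 * c + a * k + k + k + k + 1)%N by lia.
have -> : ((a + 1).+1 * c + 1 * k = a.+2 * c + k)%N by lia.
have -> : ((a + 1).+1 * (c + k) + a.+1 * k.+1 =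
  a.+2 * c + a * k + a * k + k + k + k + a + 1)%N by lia.
have -> : (a.+2 * (c + k) = a.+2 * c + a * k + k + k)%N by lia.
have -> : (a.+1 * k.+1 = a * k + k + a + 1)%N by lia.
have -> : (a.+1 * k = a * k + k)%N by lia.
have -> : (((k + d).+1).*2 = k + k + d + d + 2)%N by lia.
have -> : ((k + d).+1 + k.+1 = (k + d + k).+2)%N by lia.
have -> : ((k + d).+1 + k = (k + d + k).+1)%N by lia.
have -> : (k + d + k.+1 = (k + d + k).+1)%N by lia.
rewrite !qfactS.
move: (a.+2 * c)%N (a * k)%N => e f.
have h1 := qfact_neq0 d; have h2 := qfact_neq0 (k + d + k).
have h3 := q_regular d; have h4 := q_regular (k + d + k).
have h5 := q_regular (k + d + k).+1; have h6 := q_regular (k + d + k).+2.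
move: (P d) (P _) h1 h2 => P1 P2 h1 h2.
rewrite !(exprD, exprS, expr0) in h3 h4 h5 h6 *.
move: (q ^+ k) (q ^+ d) (q ^+ e) (q ^+ f) (q ^+ a) h3 h4 h5 h6
  => x y z t u h3 h4 h5 h6.
field_nz.
Qed.

(** Since [1 - q ^+ (n.+1).*2] is the ratio of [P n.+1 * Pm n.+1] to [P n * Pm n], a level shifted
    to [n.+1] can be read as an unshifted level at [n], with [alpha 0 a.+1] replaced by
    [alpha a 1]. *)
Lemma alpha_switch a n :
  (1 - q ^+ (n.+1).*2) * (\sum_(0 <= r < n.+2) alpha 0 a.+1 r * baileyK n.+1 r) =
  \sum_(0 <= r < n.+1) alpha a 1 r * baileyK n r.
Proof.
have := alpha_switch_partial a (leqnn n.+1); rewrite sumrB => /eqP.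
rewrite subr_eq => /eqP E.
rewrite big_nat_recr //= mulrDr mulr_sumr.
rewrite (eq_bigr _ (fun i _ => mulrA _ _ _)) E addrAC -[RHS]add0r.
(* The closed form at [k = n.+1] is the opposite of the extra term [r = n.+1]. *)
congr (_ + _); rewrite /alpha.
rewrite subnn expr0 subrr mulr0 subr0 (bin2S n.+1); move: 'C(n.+1, 2) => c.
have -> : ((0 + a.+1).+1 * c + a.+1 * n.+1 = a.+2 * c + a.+1 * n.+1)%N by lia.
have -> : ((0 + a.+1).+1 * (c + n.+1) + 1 * n.+2 =
  a.+2 * c + a.+1 * n.+1 + n + n + 3)%N by lia.
have -> : (((n.+1).*2 = n + n + 2))%N by lia.
move: (a.+2 * c)%N (a.+1 * n.+1)%N (baileyK _ _) => e f K.
rewrite !(exprD, exprS, expr0).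
ring.
Qed.


(* [chain_sum a m n] sums the product of the [q ^+ 'C(n_i.+1, 2)], [i < m], and
   of the q-binomials over [n_1, .., n_(m-1)], with [n_m = n].  Starting from
   the unit Bailey pair at [m = 0] is harmless, as [qbinom q n 0 = 1]. *)
Fixpoint chain_sum a m n : F :=
  if m is i.+1 then
    \sum_(0 <= k < (n + (a == i)).+1)
      qbinom q (n + (a == i)) k * q ^+ 'C(k.+1, 2) * chain_sum a i k
  else (n == 0%N)%:R.

Lemma chain_sum_low a j n : (j <= a)%N ->
  chain_sum a j n =
  P n * Pm n * \sum_(0 <= r < n.+1) alpha 0 j r * baileyK n r.
Proof.
elim: j n => [|j IH] n le_ja.
  rewrite /= alpha0_sum; case: n => [|n]; last by rewrite mulr0.
  by rewrite !qpoch0 !mulr1.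
rewrite /= gtn_eqF // addn0.
under eq_bigr => k _ do rewrite IH 1?ltnW //.
rewrite bailey_step; congr (_ * _).
by apply: eq_bigr => r _; rewrite alpha_shift.
Qed.

Lemma chain_sum_high a c n :
  chain_sum a (a + c.+1) n =
  P n * Pm n * \sum_(0 <= r < n.+1) alpha a c.+1 r * baileyK n r.
Proof.
elim: c n => [|c IH] n.
  (* The step from level [a] to [a.+1] carries the shift. For [a = 0] it is the auxiliary step,
     where only [k = 0] contributes and the shift changes nothing. *)
  rewrite addn1 /= eqxx addn1.
  under eq_bigr => k _ do rewrite chain_sum_low //.
  rewrite bailey_step -alpha_switch qfactS qfactNS.
  under eq_bigr => r _ do rewrite alpha_shift.
  rewrite -addnn exprD; ring.
rewrite addnS /= ltn_eqF ?addn0; last by rewrite addnS ltnS leq_addr.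
under eq_bigr => k _ do rewrite IH.
rewrite bailey_step; congr (_ * _).
by apply: eq_bigr => r _; rewrite alpha_shift.
Qed.

(** The coefficient of [alpha a c.+1 r] in the sum over the outermost index, cut to [n] values from
    [r] on. For [|q| < 1] it tends to [(-1) ^+ r * q ^+ 'C(r.+1, 2)]. *)
Definition tail_sum r n : F :=
  \sum_(0 <= i < n) (-1) ^+ (r + i) * q ^+ 'C((r + i).+1, 2) * P (r + i) *
    baileyK (r + i) r.

Lemma tail_sum0 n :
  tail_sum 0 n = 1 - (-1) ^+ n * q ^+ 'C(n.+1, 2) / P n.
Proof.
elim: n => [|n IH]; rewrite /tail_sum.
  by rewrite big_nil qpoch0 bin_small // !expr0 mul1r divr1 subrr.
rewrite big_nat_recr //= -/(tail_sum 0 n) IH /baileyK !add0n subn0 addn0.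
rewrite (bin2S n.+1) qfactS.
have h1 := qfact_neq0 n; have h2 := q_regular n.
move: 'C(n.+1, 2) (P n) h1 => c P1 h1.
rewrite !(exprD, exprS) in h2 *.
move: (q ^+ n) (q ^+ c) h2 => x t h2.
field_nz.
Qed.

(* Zeilberger's algorithm finds the recurrence in [r] and its certificate. *)
Lemma tail_sum_rec r n :
  tail_sum r.+1 n + q ^+ r.+1 * tail_sum r n.+1 =
  (-1) ^+ (r + n) * (1 + q ^+ r.+1) * q ^+ 'C((r + n).+2, 2) * P (r + n).+1 /
    (P n * P (r + r + n).+2).
Proof.
elim: n => [|n IH]; rewrite /tail_sum.
  rewrite big_nil big_nat1 /baileyK !addn0 subnn qpoch0 add0r.
  rewrite (bin2S r.+1) !qfactS.
  have h1 := qfact_neq0 (r + r); have h2 := q_regular (r + r).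
  have h3 := q_regular (r + r).+1.
  move: 'C(r.+1, 2) (P (r + r)) h1 => c P1 h1.
  rewrite !(exprD, exprS) in h2 h3 *.
  move: (q ^+ r) (q ^+ c) h2 h3 => x t h2 h3.
  field_nz.
rewrite big_nat_recr //= [in X in _ + _ * X]big_nat_recr //= mulrDr addrACA.
rewrite -/(tail_sum _ _) -/(tail_sum _ n.+1) IH /baileyK.
have -> : (r + n.+1 - r = n.+1)%N by lia.
have -> : (r.+1 + n - r.+1 = n)%N by lia.
have -> : (r.+1 + n + r.+1 = (r + r + n).+2)%N by lia.
have -> : (r + n.+1 + r = (r + r + n).+1)%N by lia.
have -> : (r + r + n.+1 = (r + r + n).+1)%N by lia.
rewrite !addnS !addSn (bin2S (r + n).+2) !qfactS.
have h1 := qfact_neq0 (r + r + n); have h2 := q_regular (r + r + n).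
have h3 := q_regular (r + r + n).+1; have h4 := q_regular (r + r + n).+2.
have h5 := q_regular n; have h6 := qfact_neq0 n.
move: 'C((r + n).+2, 2) (P (r + r + n)) (P n) h1 h6 => c P1 P2 h1 h6.
rewrite !(exprD, exprS) in h2 h3 h4 h5 *.
move: (q ^+ r) (q ^+ n) (q ^+ c) h2 h3 h4 h5 => x y t h2 h3 h4 h5.
field_nz.
Qed.

(** Exchanging the sums turns the cut [N < n] into a kernel sum of [n - r] terms for each [r]; the
    division by [Pm N] cancels that factor of the chain. *)
Lemma chain_sum_outer a c n :
  \sum_(0 <= N < n) (-1) ^+ N * q ^+ 'C(N.+1, 2) / Pm N *
    chain_sum a (a + c.+1) N =
  \sum_(0 <= r < n) alpha a c.+1 r * tail_sum r (n - r).
Proof.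
under eq_bigr => N _.
  rewrite chain_sum_high !mulr_sumr.
  over.
rewrite big_nat_triangle; apply: eq_bigr => r _; rewrite mulr_sumr.
apply: eq_bigr => i _; rewrite /baileyK.
have h1 := qfactN_neq0 (r + i); have h2 := qfact_neq0 (r + i - r).
have h3 := qfact_neq0 (r + i + r).+1.
field_nz.
Qed.

End Algebra.

(** * Unordered sums and bounds *)

Section Modulus.
Variable R : realType.
Implicit Types z w : R[i].

Lemma normcE_norm z : `|z| = (normc z)%:C%C.
Proof. by case: z. Qed.

Lemma normc_ge0 z : 0 <= normc z.
Proof. by case: z => a b; exact: sqrtr_ge0. Qed.

Lemma normc_triangle z w : normc (z + w) <= normc z + normc w.
Proof. exact: (@le_normcD R z w). Qed.

Lemma normc_opp z : normc (- z) = normc z.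
Proof. exact: (@normcN R z). Qed.

Lemma normc_exp z n : normc (z ^+ n) = normc z ^+ n.
Proof.
by elim: n => [|n IH]; rewrite ?expr0 ?normc1 // !exprS normcM IH.
Qed.

Lemma normc_sign n : normc ((-1) ^+ n : R[i]) = 1.
Proof. by rewrite normc_exp normc_opp normc1 expr1n. Qed.

Lemma normc_sum (I : Type) (s : seq I) (f : I -> R[i]) :
  normc (\sum_(i <- s) f i) <= \sum_(i <- s) normc (f i).
Proof.
elim: s => [|i s IH]; first by rewrite !big_nil normc0.
by rewrite !big_cons (le_trans (normc_triangle _ _)) // lerD2l.
Qed.

Lemma normc_ge_part z : `|complex.Re z| <= normc z /\ `|complex.Im z| <= normc z.
Proof.
case: z => a b /=; split; rewrite -sqrtr_sqr ler_wsqrtr //.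
  by rewrite lerDl sqr_ge0.
by rewrite lerDr sqr_ge0.
Qed.

Lemma normc_le_parts z : normc z <= `|complex.Re z| + `|complex.Im z|.
Proof.
case: z => a b; have -> : (a +i* b = (a +i* 0) + (0 +i* b))%C by simpc.
apply: le_trans (normc_triangle _ _) _ => /=.
by rewrite expr0n addr0 add0r !sqrtr_sqr addr0 add0r.
Qed.

End Modulus.

(** * Unordered summation along an exhaustion *)

Section Sums.
Local Open Scope fset_scope.
Local Open Scope ring_scope.
Variables (R : realType) (I : choiceType).


Lemma big_fset_split (V : nmodType) (f : I -> V) (X Y : {fset I}) :
  X `<=` Y -> \sum_(i <- Y) f i = \sum_(i <- X) f i + \sum_(i <- Y `\` X) f i.
Proof.
move=> /fsubsetP XY; rewrite (big_fsetID _ (mem X)) /=.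
have -> : [fset x | x in Y & x \in X] = X.
  apply/fsetP => i; rewrite !inE /=.
  by apply/andP/idP => [[]//|iX]; rewrite XY.
have -> // : [fset x | x in Y & x \notin X] = Y `\` X.
by apply/fsetP => i; rewrite !inE andbC.
Qed.

(** The finite sums of [g] are bounded, so some finite set comes within [e / 2] of their supremum. A
    finite set containing a late [A n] then adds at most [e / 2] to the sum over [A n]. *)
Lemma csum_exhaust (f : I -> R[i]^o) (g : I -> R) (A : nat -> {fset I})
    (l : R[i]) (B : R) :
  (forall i, normc (f i) <= g i) ->
  (forall n, \sum_(i <- A n) g i <= B) ->
  (forall X, exists n0, forall n, (n0 <= n)%N -> X `<=` A n) ->
  ((fun n => normc (\sum_(i <- A n) f i - l)) @ \oo --> (0 : R))%classic ->
  csummable f /\ csum f = l.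
Proof.
move=> le_fg gB exh cvgA.
have g0 i : 0 <= g i := le_trans (normc_ge0 _) (le_fg i).
have le_sub (X Y : {fset I}) : X `<=` Y -> \sum_(i <- X) g i <= \sum_(i <- Y) g i.
  by move=> XY; rewrite (big_fset_split _ XY) lerDl sumr_ge0.
pose E := [set s | exists X : {fset I}, s = \sum_(i <- X) g i]%classic.
have E_sup : has_sup E.
  split; first by exists (\sum_(i <- fset0) g i), fset0.
  exists B => _ [X ->]; have [n XA] := exh X.
  exact: le_trans (le_sub _ _ (XA _ (leqnn n))) (gB n).
suff cvgf : (summability.partial_sum f @ summability.totally --> (l : R[i]^o))%classic.
  have PF := @summability.totally_filter I.
  split; first by apply/cvg_ex; exists l.
  exact: (@cvg_lim _ (@norm_hausdorff _ R[i]^o) _ _ PF _ _ cvgf).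
have PF := @summability.totally_filter I.
(* A positive element of [R[i]] has zero imaginary part, so the tolerance is a real [e]. *)
apply/cvgrPdist_le => eps; case: eps => e e'; rewrite ltcE /= => /andP[/eqP -> e0].
have e20 : 0 < e / 2 by rewrite divr_gt0.
have [_ [X0 ->] X0E] := sup_adherent e20 E_sup.
have [n0 X0A] := exh X0.
move/cvgrPdist_le : cvgA => /(_ _ e20) [n1 _ An1].
pose n := maxn n0 n1.
exists (A n) => // X /= AX.
rewrite normcE_norm lecR.
have -> : summability.partial_sum f X = \sum_(i <- X) f i by rewrite big_seq_fsetE.
rewrite (big_fset_split _ AX) opprD addrA -opprB normc_opp.
apply: (le_trans (normc_triangle _ _)); rewrite opprB [leRHS]splitr lerD //; last first.
  have := An1 n; rewrite /= leq_maxr => /(_ isT).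
  by rewrite sub0r normrN ger0_norm ?normc_ge0.
apply: le_trans (normc_sum _ _) _.
apply: le_trans (ler_sum _ (fun i _ => le_fg i)) _.
have := le_sub _ _ (X0A n (leq_maxl _ _)).
have : \sum_(i <- X) g i <= sup E by apply: sup_upper_bound => //; exists X.
rewrite (big_fset_split _ AX) => ? ?; lra.
Qed.

Lemma big_fset_seq (V : nmodType) (s : seq I) (f : I -> V) : uniq s ->
  \sum_(i <- [fset i in s]) f i = \sum_(i <- s) f i.
Proof.
move=> Us; apply: perm_big; apply: uniq_perm => //.
by move=> i; rewrite !inE.
Qed.

End Sums.

(** * Quadratic exponents against geometric growth *)

Section Growth.
Variables (R : realType) (x : R).
Hypotheses (x_ge0 : 0 <= x) (x_lt1 : x < 1).

(** Consecutive terms have ratio [M * x ^+ n.+1], at most 1 from some rank on, so finitely many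
    terms bound all of them. *)
Lemma expr_bin2_bounded (M : R) : 0 <= M ->
  exists2 K, 1 <= K & forall n, M ^+ n * x ^+ 'C(n.+1, 2) <= K.
Proof.
move=> M0.
have [n0 n0P] : exists n0, forall n, (n0 <= n)%N -> M * x ^+ n <= 1.
  have M1 : 0 < (M + 1)^-1 by rewrite invr_gt0 ltr_wpDl.
  have : ((fun n => x ^+ n) @ \oo --> (0 : R))%classic.
    by apply: cvg_expr; rewrite ger0_norm.
  move/cvgrPdist_le => /(_ _ M1) [n0 _ n0P]; exists n0 => n /n0P /=.
  rewrite sub0r normrN ger0_norm ?exprn_ge0 // => le_x.
  have : M * x ^+ n <= M * (M + 1)^-1 by rewrite ler_wpM2l.
  move/le_trans; apply; rewrite ler_pdivrMr ?mul1r ?lerDl //.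
  by rewrite ltr_wpDl.
pose t n := M ^+ n * x ^+ 'C(n.+1, 2).
have t0 n : 0 <= t n by rewrite mulr_ge0 ?exprn_ge0.
pose K := 1 + \sum_(n < n0.+1) t n.
have tK n : (n <= n0)%N -> t n <= K.
  rewrite -ltnS => le_n; rewrite /K (bigD1 (Ordinal le_n)) //= addrCA lerDl.
  by rewrite addr_ge0 ?sumr_ge0.
exists K => [|n]; first by rewrite lerDl sumr_ge0.
rewrite -/(t n); case: (leqP n n0) => [/tK //|lt_n].
have [d ->] : exists d, n = (n0 + d)%N by exists (n - n0)%N; lia.
elim: d => [|d IH]; first by rewrite addn0 tK.
apply: le_trans IH; rewrite addnS /t (exprS M) (bin2S (n0 + d).+1).
rewrite (exprD x 'C((n0 + d).+1, 2)) (mulrC (x ^+ 'C(_, _))).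
rewrite mulrACA ler_piMl //.
  by rewrite mulr_ge0 ?exprn_ge0.
by rewrite n0P //; lia.
Qed.

(** Boundedness for [2 * M] leaves a factor [2^-1 ^+ n] to spare. *)
Lemma expr_bin2_geometric (M : R) : 0 <= M ->
  exists2 K, 1 <= K & forall n, M ^+ n * x ^+ 'C(n.+1, 2) <= K * 2^-1 ^+ n.
Proof.
move=> M0; have [K K1 KP] := @expr_bin2_bounded (2 * M) (mulr_ge0 (ler0n _ 2) M0).
exists K => // n; rewrite exprVn ler_pdivlMr ?exprn_gt0 //.
by rewrite mulrAC -exprMn (mulrC M).
Qed.

End Growth.

(** * Bounds on q-factorials and convergence of the kernel sums *)

Section Bounds.
Variables (R : realType) (q : R[i]).
Local Notation x := (normc q).
Hypothesis x_lt1 : x < 1.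

Local Notation P := (qpoch q q).
Local Notation Pm := (qpoch (- q) q).

Let x_ge0 : 0 <= x := normc_ge0 q.
Let x1_gt0 : 0 < 1 - x. Proof. by rewrite subr_gt0. Qed.

Lemma normc_expS_le n : normc (q ^+ n.+1) <= x.
Proof.
by rewrite normc_exp exprS ler_piMr // exprn_ile1 // ltW.
Qed.

Lemma normc_onepm_bounds w : normc w <= x -> 1 - x <= normc (1 + w) <= 2.
Proof.
move=> wx; apply/andP; split.
  have : 1 <= normc (1 + w) + normc w; last first.
    by move=> h; rewrite lerBlDr (le_trans h) // lerD2l.
  by rewrite -{1}(normc1 R) -{1}(addrK w 1) -(normc_opp w) normc_triangle.
apply: le_trans (normc_triangle _ _) _; rewrite normc1.
by rewrite (_ : 2 = 1 + 1) ?lerD2l; [exact: le_trans wx (ltW x_lt1) | ring].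
Qed.

Lemma onepm_neq0 w : normc w <= x -> 1 + w != 0.
Proof.
move=> /normc_onepm_bounds/andP[h _]; apply: contraTneq h => ->.
by rewrite normc0 -ltNge.
Qed.

Lemma q_regular n : 1 - q ^+ n.+1 != 0.
Proof. by rewrite onepm_neq0 // normc_opp normc_expS_le. Qed.

Lemma Nq_regular n : 1 + q ^+ n.+1 != 0.
Proof. by rewrite onepm_neq0 // normc_expS_le. Qed.

Local Notation L := ((1 - x)^-1).

Lemma inv_onem_ge1 : 1 <= L.
Proof. by rewrite invf_ge1 // lerBlDr lerDl. Qed.

Let L_ge0 : 0 <= L := le_trans ler01 inv_onem_ge1.

(** Each factor has modulus between [1 - x] and 2. Exponential bounds suffice, as [x ^+ 'C(n.+1, 2)]
    beats them. *)
Lemma qfact_bounds n : normc (P n) <= 2 ^+ n /\ normc (P n)^-1 <= L ^+ n.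
Proof.
elim: n => [|n [IH1 IH2]]; first by rewrite qpoch0 invr1 normc1.
have /normc_onepm_bounds/andP[h1 h2] : normc (- q ^+ n.+1) <= x.
  by rewrite normc_opp normc_expS_le.
rewrite qfactS invfM (exprSr L) (exprSr (2 : R)).
split; rewrite normcM ler_pM ?normc_ge0 //.
by rewrite normcV lef_pV2 // ?posrE // (lt_le_trans _ h1).
Qed.

Lemma qfactN_bound n : normc (Pm n)^-1 <= L ^+ n.
Proof.
elim: n => [|n IH]; first by rewrite qpoch0 invr1 normc1.
have /normc_onepm_bounds/andP[h1 h2] := normc_expS_le n.
rewrite qfactNS invfM (exprSr L) normcM ler_pM ?normc_ge0 //.
by rewrite normcV lef_pV2 // ?posrE // (lt_le_trans _ h1).
Qed.

Lemma qbinom_bound n k : normc (qbinom q n k) <= (2 * L) ^+ n.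
Proof.
rewrite /qbinom; case: leqP => [le_kn|_]; last first.
  by rewrite normc0 exprn_ge0 // mulr_ge0.
rewrite normcM exprMn ler_pM ?normc_ge0 //; first by case: (qfact_bounds n).
rewrite invfM normcM -{2}(subnK le_kn) exprD ler_pM ?normc_ge0 //.
  by case: (qfact_bounds (n - k)).
by case: (qfact_bounds k).
Qed.

(** At [r + n.+1] this bounds the right side of [tail_sum_rec]: the leading 2 is for
    [1 + q ^+ r.+1], the powers of 2 and [L] for the q-factorials. *)
Definition tail_err n : R := 2 * (2 * L) ^+ n.*2 * x ^+ 'C(n.+1, 2).

Lemma tail_err_ge0 n : 0 <= tail_err n.
Proof. by rewrite !mulr_ge0 // exprn_ge0 // mulr_ge0. Qed.

(** By induction on [r]: the recurrence passes from [(r, n.+1)] to [(r.+1, n)], keeping [r + n]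
    fixed, and each pass costs one more [tail_err]. *)
Lemma tail_sum_limit r n :
  normc (tail_sum q r n - (-1) ^+ r * q ^+ 'C(r.+1, 2)) <=
  r.+1%:R * tail_err (r + n).
Proof.
have L2_ge1 : 1 <= 2 * L by have := inv_onem_ge1; lra.
elim: r n => [|r IH] n.
  rewrite (tail_sum0 q_regular) expr0 mul1r (@bin_small 1 2) // expr0 addrAC subrr add0r.
  rewrite normc_opp mul1r add0n /tail_err normcM normcM normc_sign mul1r.
  rewrite normc_exp mulrC ler_wpM2r ?exprn_ge0 //.
  apply: le_trans (proj2 (qfact_bounds n)) _.
  have h : L ^+ n <= (2 * L) ^+ n.*2.
    rewrite -addnn exprD -[leLHS]mulr1 ler_pM ?exprn_ge0 ?exprn_ege1 //.
    by rewrite lerXn2r ?nnegrE ?mulr_ge0 //; have := inv_onem_ge1; lra.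
  by apply: le_trans h _; rewrite ler_peMl ?exprn_ge0 ?mulr_ge0 // ler1n.
(* The limits satisfy the recurrence with right side 0, so the errors satisfy it with the right side
   of [tail_sum_rec]. *)
have -> : tail_sum q r.+1 n - (-1) ^+ r.+1 * q ^+ 'C(r.+2, 2) =
    (tail_sum q r.+1 n + q ^+ r.+1 * tail_sum q r n.+1)
    + - (q ^+ r.+1 * (tail_sum q r n.+1 - (-1) ^+ r * q ^+ 'C(r.+1, 2))).
  by rewrite (bin2S r.+1) exprS (exprD q 'C(r.+1, 2)); ring.
apply: le_trans (normc_triangle _ _) _.
rewrite normc_opp (natrD _ 1 r.+1) mulrDl mul1r addSnnS lerD //; last first.
  rewrite normcM; apply: le_trans (IH n.+1).
  by rewrite ler_piMl ?normc_ge0 // (le_trans (normc_expS_le r)) // ltW.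
rewrite (tail_sum_rec q_regular) !normcM normc_sign mul1r !normc_exp /tail_err.
have -> : ((r + n.+1).*2 = n + (r + r + n).+2)%N by lia.
rewrite exprMn [L ^+ (n + _)]exprD [(r + n.+1)%N]addnS invfM normcM.
set X := x ^+ _; have X_ge0 : 0 <= X by rewrite exprn_ge0.
have -> (a b c : R) : 2 * (a * (b * c)) * X = 2 * X * a * (b * c) by ring.
have /normc_onepm_bounds/andP[_ h] := normc_expS_le r.
have le_2 : normc (P (r + n).+1) <= 2 ^+ (n + (r + r + n).+2).
  apply: le_trans (proj1 (qfact_bounds _)) _.
  by rewrite ler_eXn2l ?ltr1n //; lia.
have [_ leL1] := qfact_bounds n; have [_ leL2] := qfact_bounds (r + r + n).+2.
by do !(apply: ler_pM; rewrite ?mulr_ge0 ?normc_ge0 //).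
Qed.

(** The factor [4 ^+ n] will absorb the [n ^ 2] that comes from adding [n] errors of weight at most
    [n]. *)
Lemma tail_err_geometric : exists K, forall n, 4 ^+ n * tail_err n <= K * 2^-1 ^+ n.
Proof.
have M0 : 0 <= 4 * (2 * L) ^+ 2 by rewrite mulr_ge0 // exprn_ge0 // mulr_ge0.
have [K _ KP] := expr_bin2_geometric x_ge0 x_lt1 M0.
exists (2 * K) => n; rewrite -mulrA (le_trans _ (ler_wpM2l _ (KP n))) //.
rewrite [(4 * _) ^+ n]exprMn -[_ ^+ 2 ^+ n]exprM mul2n /tail_err le_eqVlt.
by apply/orP; left; apply/eqP; ring.
Qed.

Lemma weighted_tail_cvg (u : nat -> R[i]) :
  (forall r, normc (u r) <= 2) ->
  ((fun n => normc (\sum_(0 <= r < n)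
     u r * (tail_sum q r (n - r) - (-1) ^+ r * q ^+ 'C(r.+1, 2))))
   @ \oo --> (0 : R))%classic.
Proof.
move=> u2; have [K KP] := tail_err_geometric.
apply: (@squeeze_cvgr _ _ _ _ (fun=> 0) (fun n => 2 * K * 2^-1 ^+ n)).
- apply: nearW => n; rewrite normc_ge0 /=.
  apply: le_trans (normc_sum _ _) _.
  apply: (@le_trans _ _ (\sum_(0 <= r < n) 2 * (n%:R * tail_err n))).
    apply: ler_sum_nat => r /andP[_ lt_rn].
    rewrite normcM ler_pM ?normc_ge0 //.
    apply: le_trans (tail_sum_limit _ _) _.
    by rewrite subnKC 1?ltnW // ler_wpM2r ?tail_err_ge0 // ler_nat.
  rewrite sumr_const_nat subn0 -[_ *+ n]mulr_natl -[leRHS]mulrA.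
  rewrite mulrCA ler_pM2l // (le_trans _ (KP n)) // mulrA.
  rewrite ler_wpM2r ?tail_err_ge0 // -natrM -natrX ler_nat.
  by rewrite (_ : 4 = 2 * 2)%N // expnMn leq_mul // ltnW // ltn_expl.
- exact: cvg_cst.
- rewrite -[X in (_ --> X)%classic](mulr0 (2 * K)); apply: cvgMr; apply: cvg_expr.
  by rewrite ger0_norm ?invr_ge0 // invf_lt1 // ltr1n.
Qed.

(** Real and imaginary parts are each dominated by a geometric series, which reduces the claim to
    real series. *)
Lemma series_normc_cvg (u : nat -> R[i]) (C : R) :
  (forall n, normc (u n) <= C * x ^+ n) ->
  exists l, ((fun n => normc (\sum_(0 <= r < n) u r - l)) @ \oo --> (0 : R))%classic.
Proof.
move=> uC.
have cvg_part (f : R[i] -> R) : (forall z, `|f z| <= normc z) ->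
    cvgn (series (fun n => f (u n))).
  move=> fP; apply: normed_cvg.
  apply: (@series_le_cvg _ _ (geometric C x)) => [n|n|n|].
  - exact: normr_ge0.
  - exact: le_trans (normc_ge0 _) (uC n).
  - exact: le_trans (fP _) (uC n).
  - by apply: is_cvg_geometric_series; rewrite ger0_norm.
have /cvg_ex[a acvg] := cvg_part _ (fun z => proj1 (normc_ge_part z)).
have /cvg_ex[b bcvg] := cvg_part _ (fun z => proj2 (normc_ge_part z)).
exists (a +i* b)%C.
have cvg0 (c : R) (v : nat -> R) : (v @ \oo --> c)%classic ->
    ((fun n => `|v n - c|) @ \oo --> (0 : R))%classic.
  move=> vc; rewrite -[X in (_ --> X)%classic](@normr0 _ R) -[X in `|X|](subrr c).
  by apply: cvg_norm; apply: cvgB => //; exact: cvg_cst.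
apply: (@squeeze_cvgr _ _ _ _ (fun=> 0)
  (fun n => `|series (fun n => complex.Re (u n)) n - a| +
            `|series (fun n => complex.Im (u n)) n - b|)).
- apply: nearW => n; rewrite normc_ge0 /=.
  apply: le_trans (normc_le_parts _) _.
  rewrite !raddfB /series /= !raddf_sum //.
- exact: cvg_cst.
- by rewrite -[X in (_ --> X)%classic](addr0 0); apply: cvgD; exact: cvg0.
Qed.

End Bounds.

(** * The two exhaustions *)

Lemma geometric_sum_le (R : realFieldType) (x : R) n : 0 <= x < 1 ->
  \sum_(0 <= r < n) x ^+ r <= (1 - x)^-1.
Proof.
move=> /andP[x0 x1].
have E : (\sum_(0 <= r < n) x ^+ r) * (1 - x) = 1 - x ^+ n.
  elim: n => [|n IH]; first by rewrite big_nil mul0r subrr.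
  rewrite big_nat_recr //= mulrDl IH exprS; ring.
by rewrite -[leRHS]mul1r ler_pdivlMr ?subr_gt0 // E gerBl exprn_ge0.
Qed.

(** Tuples grow by [rcons] because [chain_sum] peels off the outermost index, which is stored
    last. *)
Fixpoint box m b : seq (m.-tuple nat) :=
  if m is k.+1 then [seq rcons_tuple t j | t <- box k b, j <- iota 0 b]
  else [:: [tuple]].

(* A shift [n_(a+1) + 1] may push the inner indices one above the outermost. *)
Definition top_box m b : seq (m.+1.-tuple nat) :=
  [seq rcons_tuple t j | t <- box m b.+1, j <- iota 0 b].

Lemma tuple_rconsP m (t : m.+1.-tuple nat) :
  exists u j, t = rcons_tuple (u : m.-tuple nat) j.
Proof.
case: t => s; case: (lastP s) => [//|s' j] st.
have su : size s' == m by move: st; rewrite size_rcons.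
by exists (Tuple su), j; apply: val_inj.
Qed.

Lemma rcons_tuple_inj m :
  injective (uncurry (fun (t : m.-tuple nat) j => rcons_tuple t j)).
Proof.
move=> [t i] [u j] /(congr1 val) /= /rcons_inj[tu ->].
by congr pair; apply: val_inj.
Qed.

Lemma box_uniq m b : uniq (box m b).
Proof.
elim: m => [//|m IH] /=; apply: allpairs_uniq (iota_uniq _ _) _ => //.
by move=> [u i] [u' i'] _ _ /rcons_tuple_inj.
Qed.

Lemma mem_box m b (t : m.-tuple nat) :
  (forall j, j \in val t -> (j < b)%N) -> t \in box m b.
Proof.
elim: m t => [t _|m IH t]; first by rewrite tuple0 inE.
have [u [j ->]] := tuple_rconsP t => tb /=.
apply: allpairs_f; last by rewrite mem_iota tb //= mem_rcons inE eqxx.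
by apply: IH => i iu; apply: tb; rewrite /= mem_rcons inE iu orbT.
Qed.

Lemma top_box_uniq m b : uniq (top_box m b).
Proof.
apply: allpairs_uniq (box_uniq _ _) (iota_uniq _ _) _.
by move=> [u i] [u' i'] _ _ /rcons_tuple_inj.
Qed.

Lemma top_box_exhaust m (X : {fset m.+1.-tuple nat}) :
  exists n0, forall n, (n0 <= n)%N -> (X `<=` [fset t in top_box m n])%fset.
Proof.
(* The total of all entries of all tuples in [X] bounds each single entry. *)
exists (\sum_(t <- X) \sum_(j <- t) j).+1%N => n le_n; apply/fsubsetP => t tX.
have tb j : j \in val t -> (j < n)%N.
  move=> jt; apply: leq_trans le_n; rewrite ltnS.
  rewrite (big_rem t) //=; apply: leq_trans (leq_addr _ _).
  by rewrite (big_rem j) //= leq_addr.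
rewrite inE; have [u [j E]] := tuple_rconsP t; rewrite E in tb *.
apply: allpairs_f; last by rewrite mem_iota tb //= mem_rcons inE eqxx.
by apply: mem_box => i iu; rewrite ltnW // ltnS tb //= mem_rcons inE iu orbT.
Qed.

Lemma box_prod_sum (F : comPzSemiRingType) (h : nat -> F) m b :
  \sum_(t <- box m b) \prod_(j <- t) h j = (\sum_(0 <= j < b) h j) ^+ m.
Proof.
elim: m => [|m IH] /=; first by rewrite big_seq1 big_nil.
rewrite big_allpairs_dep exprSr -IH mulr_suml; apply: eq_bigr => t _.
rewrite /index_iota subn0 mulr_sumr; apply: eq_bigr => j _ /=.
by rewrite big_rcons.
Qed.

Lemma top_box_prod_sum (F : comPzSemiRingType) (h : nat -> F) m b :
  \sum_(t <- top_box m b) \prod_(j <- t) h j =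
  (\sum_(0 <= j < b.+1) h j) ^+ m * \sum_(0 <= j < b) h j.
Proof.
rewrite big_allpairs_dep -box_prod_sum mulr_suml; apply: eq_bigr => t _.
rewrite /index_iota subn0 mulr_sumr; apply: eq_bigr => j _ /=.
by rewrite big_rcons.
Qed.

Section ChainWeight.
Variables (F : fieldType) (q : F) (a : nat).
Hypothesis q_regular : forall n, 1 - q ^+ n.+1 != 0.

Definition chain_weight m (t : seq nat) k : F :=
  q ^+ (\sum_(1 <= i < m.+1) 'C((nth 0%N t i.-1).+1, 2)) *
  \prod_(1 <= i < m.+1) qbinom q (nth 0%N (rcons t k) i + (a == i)) (nth 0%N t i.-1).

Lemma chain_weight_rcons m (u : m.-tuple nat) j k :
  chain_weight m.+1 (rcons u j) k =
  qbinom q (k + (a == m.+1)) j * q ^+ 'C(j.+1, 2) * chain_weight m u j.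
Proof.
rewrite /chain_weight big_nat_recr //= [in X in _ * X = _]big_nat_recr //=.
rewrite !nth_rcons !size_rcons !size_tuple ltnn eqxx ltnn eqxx exprD.
rewrite (@eq_big_nat _ _ _ 1 m.+1 _ (fun i => 'C((nth 0%N u i.-1).+1, 2))); last first.
  by move=> [//|i] /andP[_ im]; rewrite nth_rcons size_tuple -ltnS im.
rewrite (@eq_big_nat _ _ _ 1 m.+1 _ (fun i =>
  qbinom q (nth 0%N (rcons u j) i + (a == i)) (nth 0%N u i.-1))); last first.
  move=> [//|i] /andP[_ im]; rewrite [nth 0 (rcons (rcons _ _) _) _]nth_rcons.
  by rewrite size_rcons size_tuple im [nth _ _ i.+1.-1]nth_rcons size_tuple -ltnS im.
ring.
Qed.

(** The box misses no nonzero term: indices grow inwards only at the shift, and there by one. The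
    level is [m.+1] because [chain_sum] starts with an auxiliary step. *)
Lemma chain_weight_sum m b k : (k + (a < m.+1) < b)%N ->
  \sum_(t <- box m b) chain_weight m t k = chain_sum q a m.+1 k.
Proof.
elim: m k => [|m IH] k lt_kb.
  rewrite /= big_seq1 [LHS](_ : _ = 1); last first.
    by rewrite /chain_weight !big_geq // expr0 mulr1.
  rewrite big_nat_recl //= big1 => [|i _]; last by rewrite mulr0.
  rewrite addr0 /qbinom leq0n subn0 (@bin_small 1 2) // expr0 qpoch0 !mulr1.
  by rewrite divff // qfact_neq0.
rewrite [LHS]big_allpairs_dep exchange_big /=.
transitivity (\sum_(0 <= j < b) qbinom q (k + (a == m.+1)) j * q ^+ 'C(j.+1, 2)
    * \sum_(t <- box m b) chain_weight m t j).
  rewrite /index_iota subn0; apply: eq_bigr => j _; rewrite mulr_sumr.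
  by apply: eq_bigr => t _; exact: chain_weight_rcons.
(* The shift is either at this level or below it, so the bound on [b] passes to every [j] that
   contributes. *)
have le_kb : ((k + (a == m.+1)).+1 <= b)%N by lia.
rewrite (big_cat_nat _ le_kb) //= [X in _ + X]big_nat [X in _ + X]big1 ?addr0.
  apply: eq_big_nat => j /andP[_ lt_j]; rewrite IH //; lia.
by move=> j /andP[lt_j _]; rewrite /qbinom leqNgt lt_j !mul0r.
Qed.

End ChainWeight.

(** The entries [- r] and [r.+1] are paired because they index the two terms of one [alpha]. *)
Definition int_box n : seq int :=
  [seq - r%:Z | r <- iota 0 n] ++ [seq r.+1%:Z | r <- iota 0 n].

Lemma int_box_uniq n : uniq (int_box n).
Proof.
rewrite cat_uniq !map_inj_uniq ?iota_uniq /=; try by move=> i j ?; lia.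
rewrite andbT; apply/hasPn => _ /mapP[r _ ->]; apply/mapP => -[s _]; lia.
Qed.

Lemma int_box_exhaust (X : {fset int}) :
  exists n0, forall n, (n0 <= n)%N -> (X `<=` [fset i in int_box n])%fset.
Proof.
exists (\sum_(i <- X) `|i|%N).+1%N => n le_n; apply/fsubsetP => i iX.
have {le_n} i_lt : (`|i| < n)%N.
  by apply: leq_trans le_n; rewrite ltnS (big_rem i) //= leq_addr.
rewrite !inE; move: i i_lt {iX} => [[|r]|r] lt_r; apply/orP.
- by left; apply/mapP; exists 0%N; rewrite ?mem_iota.
- by right; apply/mapP; exists r; rewrite ?mem_iota //=; lia.
- by left; apply/mapP; exists r.+1; rewrite ?mem_iota ?NegzE //=; lia.
Qed.

Lemma binz2_nat n : binz2 n%:Z = 'C(n, 2)%:Z.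
Proof.
have E : n%:Z * (n%:Z - 1) = 'C(n, 2)%:Z * 2.
  by elim: n => [|n IH] //; rewrite bin2S PoszD mulrDl -IH intS; ring.
by rewrite /binz2 E mulzK.
Qed.

Lemma binz2_opp n : binz2 (- n%:Z) = 'C(n.+1, 2)%:Z.
Proof.
by rewrite -binz2_nat /binz2; congr (_ %/ _)%Z; lia.
Qed.

Lemma int_box_sum (V : nmodType) (f : int -> V) n :
  \sum_(i <- int_box n) f i = \sum_(0 <= r < n) (f (- r%:Z) + f r.+1%:Z).
Proof. by rewrite big_cat !big_map big_split /index_iota subn0. Qed.

(** * Domination of both families and the terms of the false theta series *)

Section Terms.
Variables (R : realType) (q : R[i]) (a : nat).
Local Notation x := (normc q).
Hypothesis x_lt1 : x < 1.

Let x_ge0 : 0 <= x := normc_ge0 q.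

Lemma lhs_term_rcons m (t : m.-tuple nat) k :
  lhs_term q a (rcons_tuple t k) =
  (-1) ^+ k * q ^+ 'C(k.+1, 2) / qpoch (- q) q k * chain_weight q a m t k.
Proof.
rewrite /lhs_term /chain_weight big_nat_recr //= nth_rcons size_tuple ltnn eqxx.
rewrite exprD.
rewrite (@eq_big_nat _ _ _ 1 m.+1 _ (fun i => 'C((nth 0%N t i.-1).+1, 2))); last first.
  by move=> [//|i] /andP[_ im]; rewrite nth_rcons size_tuple -ltnS im.
rewrite (@eq_big_nat _ _ _ 1 m.+1 _ (fun i =>
  qbinom q (nth 0%N (rcons t k) i + (a == i)) (nth 0%N t i.-1))); last first.
  move=> [//|i] /andP[_ im]; congr qbinom.
  by rewrite nth_rcons size_tuple -ltnS im.
ring.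
Qed.

Local Notation L := (2 / (1 - x)).

Let L_ge1 : 1 <= L.
Proof. have := inv_onem_ge1 x_lt1; lra. Qed.

Let L_ge0 : 0 <= L := le_trans ler01 L_ge1.

(** The square leaves room at the outermost index, which pays [L ^+ k] both for its q-factorial and
    for the binomial below it. *)
Let term_bound j := (L ^+ 2) ^+ j * x ^+ 'C(j.+1, 2).

(** Each binomial costs [L] to the power of its upper index, plus one [L] for a possible shift; the
    latter make up [L ^+ m]. *)
Lemma chain_weight_bound m (t : m.-tuple nat) k :
  normc (chain_weight q a m t k) <= L ^+ m * L ^+ k * \prod_(j <- t) term_bound j.
Proof.
elim: m t k => [|m IH] t k.
  rewrite /chain_weight !big_geq // (tuple0 t) big_nil !expr0 !mul1r mulr1.
  by rewrite normc1 exprn_ege1.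
have [u [j ->]] := tuple_rconsP t.
rewrite chain_weight_rcons big_rcons /= 2!normcM normc_exp.
have h1 : normc (qbinom q (k + (a == m.+1)) j) <= L * L ^+ k.
  apply: le_trans (qbinom_bound x_lt1 _ _) _.
  by rewrite -exprS ler_weXn2l //; lia.
have h2 := IH u j.
apply: (@le_trans _ _ (L * L ^+ k * x ^+ 'C(j.+1, 2) *
   (L ^+ m * L ^+ j * \prod_(i <- u) term_bound i))).
  apply: ler_pM h2; rewrite ?mulr_ge0 ?normc_ge0 ?exprn_ge0 //.
  by rewrite ler_wpM2r ?exprn_ge0.
have p0 : 0 <= \prod_(i <- u) term_bound i.
  by apply: prodr_ge0 => i _; rewrite mulr_ge0 ?exprn_ge0.
rewrite [term_bound j]/term_bound [L ^+ m.+1]exprS -[L ^+ 2 ^+ j]exprM mul2n.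
have -> (y z p : R) : L * y * z * (L ^+ m * L ^+ j * p) =
  L * L ^+ m * y * p * z * L ^+ j by ring.
have -> (y z p w : R) : L * L ^+ m * y * (p * (w * z)) =
  L * L ^+ m * y * p * z * w by ring.
apply: ler_wpM2l; last by rewrite ler_weXn2l // -addnn leq_addr.
by rewrite !mulr_ge0 ?exprn_ge0 // invr_ge0 subr_ge0 ltW.
Qed.

Lemma lhs_term_bound m : exists C, exists2 K, 0 <= C /\ 1 <= K &
  forall t : m.+1.-tuple nat,
    normc (lhs_term q a t) <= C * \prod_(j <- t) (K * 2^-1 ^+ j).
Proof.
have [K K1 KP] := expr_bin2_geometric x_ge0 x_lt1 (exprn_ge0 2 L_ge0).
exists (L ^+ m), K => [|t]; first by rewrite exprn_ge0.
have t0 i : 0 <= term_bound i by rewrite mulr_ge0 ?exprn_ge0.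
apply: (@le_trans _ _ (L ^+ m * \prod_(j <- t) term_bound j)); last first.
  by rewrite ler_wpM2l ?exprn_ge0 // ler_prod // => j _; rewrite t0 KP.
have [u [k ->]] := tuple_rconsP t.
rewrite lhs_term_rcons big_rcons /= 3!normcM normc_sign mul1r normc_exp.
have h1 : normc (qpoch (- q) q k)^-1 <= L ^+ k.
  apply: le_trans (qfactN_bound x_lt1 k) _.
  have h := inv_onem_ge1 x_lt1.
  by rewrite lerXn2r ?nnegrE ?mulr_ge0 //; lra.
have h2 := chain_weight_bound u k.
apply: (@le_trans _ _ (x ^+ 'C(k.+1, 2) * L ^+ k *
   (L ^+ m * L ^+ k * \prod_(i <- u) term_bound i))).
  apply: ler_pM h2; rewrite ?mulr_ge0 ?normc_ge0 ?exprn_ge0 //.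
  by rewrite ler_wpM2l ?exprn_ge0.
rewrite {3}/term_bound -exprM mul2n -addnn exprD le_eqVlt.
by apply/orP; left; apply/eqP; ring.
Qed.

Variable c : nat.
Local Notation rhs := (@rhs_term R q (a + c.+1) a).

Lemma rhs_term_opp r :
  rhs (- r%:Z) = q ^+ ((a + c.+2).+1 * 'C(r, 2) + c.+2 * r).
Proof.
rewrite /rhs_term opprK /sgn /= mul1r binz2_opp bin2S exprnP.
by congr (q ^ _); lia.
Qed.

Lemma rhs_term_pos r :
  rhs r.+1%:Z = - q ^+ ((a + c.+2).+1 * 'C(r.+1, 2) + a.+1 * r.+1).
Proof.
rewrite /rhs_term binz2_nat exprnP (_ : sgn _ = -1) // mulN1r.
by congr (- q ^ _); lia.
Qed.

Lemma rhs_term_bound n : normc (rhs n) <= x ^+ `|n|%N.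
Proof.
case: n => [[|r]|r].
- have := rhs_term_opp 0; rewrite oppr0 => ->; rewrite normc_exp muln0.
  by rewrite addn0 absz0 bin_small // muln0.
- rewrite rhs_term_pos normc_opp normc_exp ler_wiXn2l ?(ltW x_lt1) //.
  by rewrite (leq_trans _ (leq_addl _ _)) // leq_pmull.
- rewrite NegzE rhs_term_opp normc_exp ler_wiXn2l ?(ltW x_lt1) //.
  by rewrite (leq_trans _ (leq_addl _ _)) // leq_pmull.
Qed.

(** The limit of the kernel sum supplies one more Bailey factor and a sign that cancels the sign of
    [alpha]. *)
Lemma rhs_int_box_sum n : \sum_(i <- int_box n) rhs i =
  \sum_(0 <= r < n) (-1) ^+ r * (q ^+ 'C(r.+1, 2) * alpha q a c.+1 r).
Proof.
rewrite int_box_sum; apply: eq_bigr => r _.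
by rewrite rhs_term_opp rhs_term_pos alpha_shift /alpha mulrA -expr2 sqrr_sign mul1r.
Qed.

Lemma alpha_bound r : normc (alpha q a c r) <= 2.
Proof.
rewrite /alpha normcM normc_sign mul1r (le_trans (normc_triangle _ _)) //.
by rewrite normc_opp !normc_exp -[leRHS]/(1 + 1) lerD // exprn_ile1 // ltW.
Qed.

End Terms.

(** * The common limit of the two exhaustions *)

Section Main.
Variables (R : realType) (q : R[i]) (a c : nat).
Local Notation x := (normc q).
Hypothesis x_lt1 : x < 1.

Let x_itv : 0 <= x < 1. Proof. by rewrite normc_ge0. Qed.

Local Notation rhs_partial n :=
  (\sum_(0 <= r < n) (-1) ^+ r * (q ^+ 'C(r.+1, 2) * alpha q a c.+1 r)).

Lemma rhs_limit : exists l,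
  ((fun n => normc (rhs_partial n - l)) @ \oo --> (0 : R))%classic.
Proof.
apply: (@series_normc_cvg _ _ x_lt1 _ 2) => r.
rewrite normcM normc_sign mul1r normcM mulrC ler_pM ?normc_ge0 //.
  exact: alpha_bound.
rewrite normc_exp ler_wiXn2l ?normc_ge0 ?(ltW x_lt1) // bin2S leq_addl //.
Qed.

Lemma rhs_csum l :
  ((fun n => normc (rhs_partial n - l)) @ \oo --> (0 : R))%classic ->
  csummable (@rhs_term R q (a + c.+1) a) /\ csum (@rhs_term R q (a + c.+1) a) = l.
Proof.
move=> cvgl.
pose A n := [fset i in int_box n]%fset.
apply: (@csum_exhaust _ _ _ (fun i : int => x ^+ `|i|%N) A _ (2 * (1 - x)^-1)).
- exact: rhs_term_bound.
- move=> n; rewrite /A big_fset_seq ?int_box_uniq //.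
  rewrite [leLHS](int_box_sum (fun i : int => x ^+ `|i|%N) n).
  apply: le_trans (ler_wpM2l _ (geometric_sum_le n x_itv)); rewrite // mulr_sumr.
  apply: ler_sum => r _; rewrite abszN /= (_ : 2 = 1 + 1) // mulrDl mul1r lerD2l.
  by rewrite ler_wiXn2l ?normc_ge0 ?(ltW x_lt1).
- exact: int_box_exhaust.
- rewrite (_ : (fun n => _) = (fun n => normc (rhs_partial n - l))) //.
  by apply/funext => n; rewrite /A big_fset_seq ?int_box_uniq // rhs_int_box_sum.
Qed.

Lemma lhs_csum l :
  ((fun n => normc (rhs_partial n - l)) @ \oo --> (0 : R))%classic ->
  csummable (@lhs_term R q (a + c).+1 a) /\ csum (@lhs_term R q (a + c).+1 a) = l.
Proof.
move=> cvgl; have [C0 [K [C0_ge0 K_ge1] bnd]] := lhs_term_bound a x_lt1 (a + c).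
pose A n := [fset t in top_box (a + c) n]%fset.
have K_ge0 : 0 <= K := le_trans ler01 K_ge1.
have half_itv : 0 <= (2^-1 : R) < 1 by rewrite invr_ge0 invf_lt1 // ltr1n ler0n.
have sumK n : 0 <= \sum_(0 <= j < n) K * 2^-1 ^+ j <= 2 * K.
  rewrite sumr_ge0 /= => [|j _]; last by rewrite mulr_ge0 ?exprn_ge0 ?invr_ge0.
  rewrite -mulr_sumr mulrC ler_wpM2r // (le_trans (geometric_sum_le n half_itv)) //.
  by rewrite le_eqVlt; apply/orP; left; apply/eqP; field.
apply: (@csum_exhaust _ _ _ _ A _ (C0 * ((2 * K) ^+ (a + c) * (2 * K))) bnd).
- move=> n; rewrite /A big_fset_seq ?top_box_uniq // -mulr_sumr top_box_prod_sum.
  have /andP[s1 s2] := sumK n.+1; have /andP[s3 s4] := sumK n.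
  by rewrite ler_wpM2l // ler_pM ?exprn_ge0 // lerXn2r ?nnegrE ?mulr_ge0.
- exact: top_box_exhaust.
(* [d n] is the gap between the left partial sum and the false theta partial sum, due to cutting the
   kernel sums. *)
pose d n := \sum_(0 <= r < n)
  alpha q a c.+1 r * (tail_sum q r (n - r) - (-1) ^+ r * q ^+ 'C(r.+1, 2)).
apply: (@squeeze_cvgr _ _ _ _ (fun=> 0)
  (fun n => normc (d n) + normc (rhs_partial n - l))).
- apply: nearW => n; rewrite normc_ge0 /=.
  apply: le_trans (normc_triangle _ _); rewrite le_eqVlt; apply/orP; left.
  apply/eqP; congr normc; rewrite addrA; congr (_ - _).
  rewrite /A big_fset_seq ?top_box_uniq // /d -big_split /=.
  transitivity (\sum_(0 <= r < n) alpha q a c.+1 r * tail_sum q r (n - r)).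
    rewrite -(chain_sum_outer (q_regular x_lt1) (Nq_regular x_lt1)).
    rewrite big_allpairs_dep exchange_big /= /index_iota subn0.
    rewrite big_seq [RHS]big_seq; apply: eq_bigr => k.
    rewrite mem_iota => /andP[_ lt_kn].
    (* As [k < n], the inner indices are at most [n] even after a shift, hence the side [n.+1]. *)
    rewrite addnS -(@chain_weight_sum _ _ _ (q_regular x_lt1) _ n.+1) ?mulr_sumr;
      last by lia.
    by apply: eq_bigr => t _; rewrite lhs_term_rcons.
  by apply: eq_bigr => r _; ring.
- exact: cvg_cst.
- rewrite -[X in (_ --> X)%classic](addr0 0); apply: cvgD => //.
  by apply: weighted_tail_cvg => // r; apply: alpha_bound.
Qed.

End Main.

Theorem theorem1p4 (R : realType) (q : R[i]) (m a : nat)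
    (hq : 0 < `|q| < 1) (hm : (1 <= m)%N) (ha : (a <= m - 1)%N) :
  [/\ csummable (@lhs_term R q m a),
      csummable (@rhs_term R q m a) &
      csum (@lhs_term R q m a) = csum (@rhs_term R q m a)].
Proof.
have x_lt1 : normc q < 1 by case/andP: hq => _; rewrite normcE_norm ltcR.
have [c ->] : exists c, m = (a + c).+1 by exists (m - 1 - a)%N; lia.
have [l cvgl] := rhs_limit a c x_lt1.
have [sl el] := lhs_csum x_lt1 cvgl; have := rhs_csum x_lt1 cvgl.
by rewrite addnS => -[sr er]; split; rewrite ?el ?er.
Qed.
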